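(* Let $p$ be an odd prime and let $G$ be a finite group whose exponent is equal to $p$. Then $G$ has property $(\hat{s})$.
   Context: The exponent of a finite group is the least common multiple of the orders of its elements. Let $F$ be a fixed algebraically closed field of characteristic $0$. For $A\in GL_n(F)$ let $\sigma(A)\subseteq F$ be its set of eigenvalues. A matrix group $\mathcal{G}\subseteq GL_n(F)$ has property $(s)$ if $\sigma(AB)\subseteq\sigma(A)\sigma(B)=\{\lambda\mu:\lambda\in\sigma(A),\mu\in\sigma(B)\}$ for all $A,B\in\mathcal{G}$. A finite group $G$ has property $(\hat{s})$ if for every subgroup $H\le G$ and every irreducible representation $\varrho:H\to GL_n(F)$ the matrix group $\varrho(H)$ has property $(s)$. *)

(* Defs.v *)
From HB Require Import structures.
From mathcomp Require Import all_boot all_order all_algebra.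
From mathcomp Require Import all_fingroup all_solvable all_character.

Set Implicit Arguments.
Unset Strict Implicit.
Unset Printing Implicit Defensive.

Import GRing.Theory.
Local Open Scope ring_scope.

(* A set of matrices is a Prop-valued predicate, since GL_n(F) is infinite.
   [property_s] only needs membership; the image of a representation is a
   group by [repr_image1], [repr_imageM], [repr_imageV], [repr_image_unit]. *)
Definition property_s (F : fieldType) (n : nat) (S : 'M[F]_n -> Prop) : Prop :=
  forall A B : 'M[F]_n, S A -> S B ->
  forall c : F, eigenvalue (A *m B) c ->
  exists l m : F, [/\ eigenvalue A l, eigenvalue B m & c = l * m].

Definition repr_image (F : fieldType) (gT : finGroupType) (H : {group gT})
    (n : nat) (rH : mx_representation F H n) : 'M[F]_n -> Prop :=
  fun A => exists2 x, x \in H & A = rH x.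

(* [mx_irreducible] excludes the representation of degree 0. *)
Definition property_s_hat (F : fieldType) (gT : finGroupType)
    (G : {group gT}) : Prop :=
  forall H : {group gT}, H \subset G ->
  forall (n : nat) (rH : mx_representation F H n),
  mx_irreducible rH -> property_s (repr_image rH).

Section ReprImage.

Variables (F : fieldType) (gT : finGroupType) (H : {group gT}) (n : nat).
Variable rH : mx_representation F H n.

Lemma repr_image1 : repr_image rH 1%:M.
Proof. by exists 1%g; rewrite ?group1 ?repr_mx1. Qed.

Lemma repr_imageM A B :
  repr_image rH A -> repr_image rH B -> repr_image rH (A *m B).
Proof.
move=> [x Hx ->] [y Hy ->]; exists (x * y)%g; first exact: groupM.
by rewrite repr_mxM.
Qed.

Lemma repr_image_unit A : repr_image rH A -> A \in unitmx.
Proof. by move=> [x Hx ->]; apply: repr_mx_unit. Qed.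

Lemma repr_imageV A : repr_image rH A -> repr_image rH (invmx A).
Proof.
by move=> [x Hx ->]; exists x^-1%g; rewrite ?groupV // repr_mxV.
Qed.

End ReprImage.

(* Main.v *)
(** By complete reducibility an eigenvalue [c] of [rho x * rho y] already occurs
    on an irreducible constituent of the restriction of [rho] to [<x, y>], so we
    may assume that [rho] is irreducible and that [x], [y] generate the group.
    If the matrices are not all scalar, let [z] represent a nontrivial central
    element of the [p]-group of these matrices modulo scalars.  Then [z] commutes
    with [x] and [y] up to scalars, and by Schur's lemma one of the two
    scalars, say [zeta] for [x], is not [1].  Conjugation by [z] shows that the
    spectrum of [rho x] is stable under multiplication by [zeta]; hence it
    consists of all [p]-th roots of unity, and [c] factors as required. *)

Require Import Defs.
From HB Require Import structures.
From mathcomp Require Import all_boot all_order all_algebra.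
From mathcomp Require Import all_fingroup all_solvable all_character.

Set Implicit Arguments.
Unset Strict Implicit.
Unset Printing Implicit Defensive.

Import GRing.Theory.
Local Open Scope ring_scope.

(** Descent on submodules containing a [c]-eigenvector: when such a submodule splits as a direct
    sum, each component of the eigenvector is zero or again a [c]-eigenvector, so one can pass to a
    summand of smaller rank until it is simple. *)
Lemma eigenvalue_mxsimple (F : decFieldType) (gT : finGroupType)
    (G : {group gT}) (n : nat) (rG : mx_representation F G n) (x : gT) (c : F) :
    x \in G -> mx_completely_reducible rG 1%:M -> eigenvalue (rG x) c ->
  exists U : 'M_n, exists2 modU : mxmodule rG U,
    mxsimple rG U & eigenvalue (submod_repr modU x) c.
Proof.
move=> Gx redG /eigenvalueP[v0 v0c v0_nz].
have eig_simple k (V : 'M_n) (v : 'rV_n) :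
    (\rank V <= k)%N -> mxmodule rG V -> (v <= V)%MS -> v != 0 ->
    v *m rG x = c *: v ->
  exists U : 'M_n, exists2 modU : mxmodule rG U,
    mxsimple rG U & eigenvalue (submod_repr modU x) c.
  elim: k V v => [|k IHk] V v leVk modV vV v_nz vc.
    have /eqP V0 : V == 0 by rewrite -mxrank_eq0 -leqn0.
    by rewrite V0 submx0 (negPf v_nz) in vV.
  have V_nz : V != 0.
    by apply: contraNneq v_nz => V0; rewrite V0 submx0 in vV.
  have [[U /and4P[modU sUV U_nz ltUV]]|simV] := mxnonsimpleP rG V_nz.
    have redV := mx_reducibleS modV (submx1 V) redG.
    have [W modW defV dxUW] := redV U modU sUV.
    have rV : \rank V = (\rank U + \rank W)%N.
      by rewrite -defV; apply/eqP; rewrite -mxdirectE.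
    have leUk : (\rank U <= k)%N by rewrite -ltnS (leq_trans ltUV).
    have leWk : (\rank W <= k)%N.
      rewrite -ltnS (leq_trans _ leVk) // rV -{1}[\rank W]add0n ltn_add2r.
      by rewrite lt0n mxrank_eq0.
    have dx0 : (U :&: W = 0)%MS by apply/mxdirect_addsP.
    have : (v <= U + W)%MS by rewrite defV.
    case/sub_addsmxP => -[a b] /= defv.
    have [aU bW] : (a *m U <= U)%MS /\ (b *m W <= W)%MS by rewrite !submxMl.
    (* The eigenvector equation is sorted so that the left side lies in [U] and the right side in
       [W]; as [U] and [W] meet in 0, both sides vanish. *)
    have eq0 : a *m U *m rG x - c *: (a *m U) = c *: (b *m W) - b *m W *m rG x.
      apply/eqP; rewrite subr_eq addrAC eq_sym subr_eq -scalerDr.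
      by rewrite [b *m W + _]addrC -mulmxDl -defv vc.
    have d0 : a *m U *m rG x - c *: (a *m U) = 0.
      apply/eqP; rewrite -submx0 -dx0 sub_capmx {2}eq0.
      by rewrite !addmx_sub ?eqmx_opp ?scalemx_sub ?(mxmodule_trans _ Gx).
    have [aU0|aU_nz] := eqVneq (a *m U) 0.
      apply: (IHk W (b *m W)) => //.
        by apply: contraNneq v_nz => bW0; rewrite defv aU0 bW0 addr0.
      by apply/esym/eqP; rewrite -subr_eq0 -eq0 d0.
    by apply: (IHk U (a *m U)) => //; apply/eqP; rewrite -subr_eq0 d0.
  exists V, modV; first by apply/mxsimpleP.
  apply/eigenvalueP; exists (in_submod V v).
    by rewrite -in_submodJ // vc linearZ.
  by apply: contraNneq v_nz => v0'; rewrite -(in_submodK vV) v0' linear0.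
exact: (eig_simple n 1%:M v0 (rank_leq_row _) (mxmodule1 rG) (submx1 v0)).
Qed.

Lemma eigenvalue_submod (F : fieldType) (gT : finGroupType)
    (G : {group gT}) (n : nat) (rG : mx_representation F G n) (U : 'M_n)
    (modU : mxmodule rG U) (x : gT) (c : F) :
  x \in G -> eigenvalue (submod_repr modU x) c -> eigenvalue (rG x) c.
Proof.
move=> Gx /eigenvalueP[v vc v_nz]; apply/eigenvalueP; exists (val_submod v).
  by rewrite -(val_submodJ modU) // vc linearZ.
by rewrite val_submod_eq0.
Qed.

Lemma eigenvalue_exists (F : closedFieldType) (n : nat) (A : 'M[F]_n) :
  (0 < n)%N -> exists a, eigenvalue A a.
Proof.
move=> n_gt0; have : size (char_poly A) != 1%N.
  by rewrite size_char_poly eqSS -lt0n.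
by case/closed_rootP=> a; exists a; rewrite eigenvalue_root_char.
Qed.

Lemma eigenvalue_scalar_mx (F : fieldType) (n : nat) (a c : F) :
  (0 < n)%N -> eigenvalue (a%:M : 'M_n) c = (c == a).
Proof.
case: n => // n _; apply/eigenvalueP/eqP => [[v]|->].
  rewrite mul_mx_scalar => /eqP; rewrite -subr_eq0 -scalerBl scaler_eq0 subr_eq0.
  by case/orP=> [/eqP//|/eqP->]; rewrite eqxx.
by exists (const_mx 1); rewrite ?mul_mx_scalar // -[const_mx 1]scale1r
  scaler_eq0 oner_eq0 /=; apply/eqP=> /matrixP/(_ 0 0)/eqP; rewrite !mxE oner_eq0.
Qed.

Lemma eigenvalue_repr_expr_eq1 (F : fieldType) (gT : finGroupType)
    (G : {group gT}) (n : nat) (rG : mx_representation F G n) (p : nat)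
    (x : gT) (a : F) :
  (exponent G %| p)%N -> x \in G -> eigenvalue (rG x) a -> a ^+ p = 1.
Proof.
move=> expG Gx /eigenvalueP[v va v_nz].
have vX k : v *m rG (x ^+ k)%g = a ^+ k *: v.
  elim: k => [|k IHk]; first by rewrite expg0 repr_mx1 mulmx1 scale1r.
  by rewrite expgSr repr_mxM ?groupX // mulmxA IHk -scalemxAl va scalerA exprSr.
have /eqP := vX p; rewrite (exponentP expG) // repr_mx1 mulmx1 -subr_eq0.
rewrite -{1}[v]scale1r -scalerBl scaler_eq0 (negPf v_nz) orbF subr_eq0.
by move/eqP.
Qed.

(** If the row vector [v] is an eigenvector of [A] for [a], then [v *m B] is one for [c * a]. *)
Lemma eigenvalue_conj_scale (F : fieldType) (n : nat) (A B : 'M[F]_n) (c a : F) :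
    B \in unitmx -> B *m A = c *: (A *m B) ->
  eigenvalue A a -> eigenvalue A (c * a).
Proof.
move=> uB BA /eigenvalueP[v va v_nz]; apply/eigenvalueP; exists (v *m B).
  by rewrite -mulmxA BA -scalemxAr mulmxA va -scalemxAl scalerA.
by apply: contraNneq v_nz => vB0; rewrite -(mulmxK uB v) vB0 mul0mx.
Qed.

Lemma prime_unity_root_primitive (F : fieldType) (p : nat) (z : F) :
  prime p -> z ^+ p = 1 -> z != 1 -> p.-primitive_root z.
Proof.
move=> p_pr zp1 z_neq1.
have [m prim_m dv_mp] := prim_order_exists (prime_gt0 p_pr) zp1.
have /primeP[_ /(_ _ dv_mp)/pred2P[m1|<- //]] := p_pr.
by case/eqP: z_neq1; rewrite -(prim_expr_order prim_m) m1 expr1.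
Qed.

(** The ratio [d / a] is a [p]-th root of unity, hence a power of [z], so [d] is reached from [a] by
    repeated multiplication by [z]. *)
Lemma eigenvalue_unity_roots (F : fieldType) (n p : nat) (A : 'M[F]_n)
    (z a d : F) :
    p.-primitive_root z ->
    (forall e, eigenvalue A e -> eigenvalue A (z * e)) ->
    eigenvalue A a -> a ^+ p = 1 -> d ^+ p = 1 ->
  eigenvalue A d.
Proof.
move=> prim_z stabA eig_a ap1 dp1.
have a_nz : a != 0.
  apply: contra_eq_neq ap1 => ->.
  by rewrite expr0n gtn_eqF ?(prim_order_gt0 prim_z) // eq_sym oner_eq0.
have [k def_k] : {k : 'I_p | d / a = z ^+ k}.
  by apply: (prim_rootP prim_z); rewrite expr_div_n ap1 dp1 divr1.
rewrite -(divfK a_nz d) def_k; elim: (nat_of_ord k) => [|i IHi].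
  by rewrite mul1r.
by rewrite exprS -mulrA; apply: stabA.
Qed.

Lemma eigenvalue_mul_irr_generated (F : closedFieldType) (p : nat)
    (gT : finGroupType) (K : {group gT}) (n : nat)
    (rK : mx_representation F K n) (x y : gT) (c : F) :
    prime p -> (exponent K %| p)%N -> x \in K -> y \in K ->
    K \subset <<[set x; y]>>%g -> mx_irreducible rK ->
    eigenvalue (rK x *m rK y) c ->
  exists l m : F, [/\ eigenvalue (rK x) l, eigenvalue (rK y) m & c = l * m].
Proof.
move=> p_pr expK Kx Ky genK irrK eig_c.
have /mx_irrP[n_gt0 _] := irrK.
have absK := group_closure_closed_field irrK.
have [a eig_a] := eigenvalue_exists (rK x) n_gt0.
have [b eig_b] := eigenvalue_exists (rK y) n_gt0.
have [sKZ|not_sKZ] := boolP (K \subset rcenter rK).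
  have /setIdP[_ /is_scalar_mxP[a' def_x]] := subsetP sKZ x Kx.
  have /setIdP[_ /is_scalar_mxP[b' def_y]] := subsetP sKZ y Ky.
  exists a', b'; rewrite def_x def_y !eigenvalue_scalar_mx //; split=> //.
  move: eig_c; rewrite def_x def_y -scalar_mxM eigenvalue_scalar_mx //.
  by move/eqP.
have nZK := normal_norm (rcenter_normal rK).
have pK : (p.-group K)%g.
  by rewrite -pnat_exponent (pnat_dvd expK) // pnat_id.
(* A nontrivial [p]-group has a nontrivial center; [z] below lifts a nontrivial element of it. *)
have : 'Z(K / rcenter rK)%g != 1%g.
  rewrite center_nil_eq1 ?(pgroup_nil (quotient_pgroup _ pK)) //.
  by rewrite -subG1 quotient_sub1.
case/trivgPn=> zb /setIP[/morphimP[z nZz Kz ->] /centP cKz] nt_z.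
have commZ w : w \in K -> exists2 u : F,
    u ^+ p = 1 & rK z *m rK w = u *: (rK w *m rK z).
  move=> Kw; have nZw := subsetP nZK w Kw.
  (* The coset of [z] is central, so the commutator acts as a scalar [u]. This [u] is an eigenvalue
     of an element of [K], whence [u ^+ p = 1]. *)
  have /setIdP[Kzw /is_scalar_mxP[u def_u]] : [~ z, w]%g \in rcenter rK.
    rewrite coset_idr ?groupR // morphR //; apply/eqP/commgP.
    by apply: cKz; apply: mem_quotient.
  exists u.
    apply: (eigenvalue_repr_expr_eq1 expK Kzw (rG := rK)).
    by rewrite def_u eigenvalue_scalar_mx.
  rewrite -repr_mxM // commgC (repr_mxM rK (groupM Kw Kz) Kzw) def_u.
  by rewrite mul_mx_scalar repr_mxM.
have full w a' d u : w \in K -> u ^+ p = 1 -> u != 1 ->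
    rK z *m rK w = u *: (rK w *m rK z) ->
  eigenvalue (rK w) a' -> d ^+ p = 1 -> eigenvalue (rK w) d.
  move=> Kw up1 u_neq1 zw eig_a' dp1.
  apply: (eigenvalue_unity_roots (prime_unity_root_primitive p_pr up1 u_neq1)
            _ eig_a' _ dp1).
    by move=> e; apply: eigenvalue_conj_scale zw; apply: repr_mx_unit.
  exact: eigenvalue_repr_expr_eq1 eig_a'.
have ap1 := eigenvalue_repr_expr_eq1 expK Kx eig_a.
have bp1 := eigenvalue_repr_expr_eq1 expK Ky eig_b.
have cp1 : c ^+ p = 1.
  apply: (eigenvalue_repr_expr_eq1 expK (groupM Kx Ky) (rG := rK)).
  by rewrite repr_mxM.
have unity_nz (e : F) : e ^+ p = 1 -> e != 0.
  move=> ep1; apply: contra_eq_neq ep1 => ->.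
  by rewrite expr0n gtn_eqF ?prime_gt0 // eq_sym oner_eq0.
have [u up1 zx] := commZ x Kx; have [v vp1 zy] := commZ y Ky.
(* If [u] is not 1, every [p]-th root of unity is an eigenvalue of [rK x], in particular [c / b],
   for whichever eigenvalue [b] of [rK y] was chosen. The case of [v] is symmetric. *)
have [u1|u_neq1] := eqVneq u 1; last first.
  exists (c / b), b; rewrite divfK ?unity_nz //; split=> //.
  by apply: (full x a _ u); rewrite // expr_div_n cp1 bp1 divr1.
have [v1|v_neq1] := eqVneq v 1; last first.
  exists a, (c / a); rewrite [a * _]mulrC divfK ?unity_nz //; split=> //.
  by apply: (full y b _ v); rewrite // expr_div_n cp1 ap1 divr1.
(* Now [rK z] commutes with the images of both generators, so Schur's lemma makes it scalar,
   contradicting the choice of [z]. *)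
case/eqP: nt_z; apply: coset_id; rewrite inE Kz.
apply: (mx_abs_irr_cent_scalar absK).
apply: subset_trans genK _; rewrite gen_subG.
by apply/subsetP=> w /set2P[]->; rewrite inE ?Kx ?Ky /= ?zx ?zy ?u1 ?v1 scale1r.
Qed.

Theorem theorem5p1 (F : closedFieldType) (charF0 : [pchar F] =i pred0)
    (p : nat) (p_prime : prime p) (p_odd : odd p)
    (gT : finGroupType) (G : {group gT}) (expG : exponent G = p) :
  property_s_hat F G.
Proof.
move=> H sHG n rH _ _ _ [x Hx ->] [y Hy ->] c eig_c.
pose K := <<[set x; y]>>%G.
have sKH : K \subset H.
  by rewrite gen_subG; apply/subsetP=> w /set2P[]->.
have [Kx Ky] : x \in K /\ y \in K by rewrite !mem_gen ?set21 ?set22.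
have expK : (exponent K %| p)%N.
  by rewrite -expG exponentS // (subset_trans sKH).
pose rK := subg_repr rH sKH.
(* Maschke's theorem applies, since in characteristic 0 the order of [K] is invertible in [F]. *)
have redK : mx_completely_reducible rK 1%:M.
  apply: mx_Maschke_pchar; apply: sub_in_pnat (pnat_pi (cardG_gt0 K)) => q _ _.
  by rewrite inE /= charF0.
have eigK : eigenvalue (rK (x * y)%g) c by rewrite repr_mxM.
have [U [modU simU eigU]] := eigenvalue_mxsimple (groupM Kx Ky) redK eigK.
have [||l [m [eig_l eig_m ->]]] :=
    eigenvalue_mul_irr_generated (rK := submod_repr modU) (c := c)
      p_prime expK Kx Ky (subxx _).
- exact/submod_mx_irr.
- by rewrite -repr_mxM.
exists l, m; split=> //.
  exact: (eigenvalue_submod (modU := modU) Kx eig_l).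
exact: (eigenvalue_submod (modU := modU) Ky eig_m).
Qed.
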